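(* Let $\mathcal{S}_\tau$ be an admissible supercritical regime (in density-energy coordinates), let $P\in\mathbb{R}_+$ and let $\boldsymbol{\tau}_1=(\rho_1,\varepsilon_1),\boldsymbol{\tau}_2=(\rho_2,\varepsilon_2)\in\Gamma_P$ be such that $\varepsilon_\rho$ is defined at $\boldsymbol{\tau}_1$ and $\boldsymbol{\tau}_2$. Then a pair $(\tilde\rho,\tilde\varepsilon)\in\mathbb{R}^2$ satisfies the compatibility condition $$\tilde\rho\,\Delta\varepsilon_\rho=\Delta(\rho\varepsilon_\rho)-\Delta\varepsilon,\qquad \tilde\varepsilon=\overline{\varepsilon}+\tilde\rho\,\overline{\varepsilon_\rho}-\overline{\rho\varepsilon_\rho}$$ between $\boldsymbol{\tau}_1$ and $\boldsymbol{\tau}_2$ if and only if $(\tilde\rho,\tilde\varepsilon)\in L_{\boldsymbol{\tau}_1}\Gamma_P\cap L_{\boldsymbol{\tau}_2}\Gamma_P$. Consequently, if $\varepsilon_\rho$ is defined on $\Gamma_P$, the compatibility condition is solvable for $(\tilde\rho,\tilde\varepsilon)$ for all pairs $\boldsymbol{\tau}_1,\boldsymbol{\tau}_2\in\Gamma_P$ if and only if $L_{\boldsymbol{\tau}_1}\Gamma_P\cap L_{\boldsymbol{\tau}_2}\Gamma_P\neq\varnothing$ for all $\boldsymbol{\tau}_1,\boldsymbol{\tau}_2\in\Gamma_P$.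
   Context: **Equation of state.** Fix $\sigma_{\min}\in\mathbb{R}$ and let $\mathcal{T}=\{(\nu,\sigma)\in\mathbb{R}^2:\nu>0,\ \sigma\ge\sigma_{\min}\}$. An equation of state is a function $e:\mathcal{T}\to\mathbb{R}$ that is $C^1$ and piecewise twice continuously differentiable. Subscripts on $e$ and $p$ denote partial derivatives. Pressure and temperature in $(\nu,\sigma)$-coordinates are $\hat p:=-e_\nu$ and $T:=e_\sigma$. $\mathbb{R}_+$ denotes the positive reals. **Admissible supercritical regime.** A nonempty set $\mathcal{S}_\eta\subset\operatorname{int}(\mathcal{T})$, open in $\mathbb{R}^2$, is an admissible supercritical regime if: (1) $e\in C^2(\mathcal{S}_\eta)$; (2) $\hat p>0$ and $T>0$ on $\mathcal{S}_\eta$, and for each fixed $\nu$ the map $\sigma\mapsto e(\nu,\sigma)$ is injective on $\{\sigma:(\nu,\sigma)\in\mathcal{S}_\eta\}$; (3) $e_{\nu\nu}>0$, $e_{\sigma\sigma}>0$ and $e_{\nu\nu}e_{\sigma\sigma}>(e_{\nu\sigma})^2$ on $\mathcal{S}_\eta$. **Density-energy coordinates.** $\Phi:\mathcal{S}_\eta\to\mathbb{R}^2$, $\Phi(\nu,\sigma)=(1/\nu,\ e(\nu,\sigma)/\nu)=:(\rho,\varepsilon)$, is a $C^2$ diffeomorphism onto its image $\mathcal{S}_\tau:=\Phi(\mathcal{S}_\eta)$, which is called an admissible supercritical regime in density-energy coordinates; its points are $\boldsymbol{\tau}=(\rho,\varepsilon)$. The pressure on $\mathcal{S}_\tau$ is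 $p(\boldsymbol{\tau}):=\hat p(\Phi^{-1}(\boldsymbol{\tau}))$; it is $C^1$ with nowhere vanishing gradient. **Isobars and tangent lines.** For $P\in\mathbb{R}_+$, $\Gamma_P:=\{\boldsymbol{\tau}\in\mathcal{S}_\tau:p(\boldsymbol{\tau})=P\}$. Near each of its points $\Gamma_P$ has a regular local $C^1$ parameterization $\varphi:I\to\Gamma_P$ ($I$ an open interval, $\varphi'\ne 0$). For $\boldsymbol{\tau}=\varphi(t)\in\Gamma_P$, the tangent space is $T_{\boldsymbol{\tau}}\Gamma_P:=\operatorname{span}(\varphi'(t))\subset\mathbb{R}^2$ (independent of $\varphi$), and the tangent line is $L_{\boldsymbol{\tau}}\Gamma_P:=\boldsymbol{\tau}+T_{\boldsymbol{\tau}}\Gamma_P$. **Slope and two-point notation.** $\varepsilon_\rho$ is the derivative of $\varepsilon$ with respect to $\rho$ at constant pressure, $\varepsilon_\rho=-p_\rho/p_\varepsilon$ evaluated at the given point of $\Gamma_P$ (the slope of $\Gamma_P$ as a graph over $\rho$); it is defined at $\boldsymbol{\tau}\in\Gamma_P$ when $p_\varepsilon(\boldsymbol{\tau})\neq0$. For a function $a$ of the state, $\Delta a:=a(\boldsymbol{\tau}_2)-a(\boldsymbol{\tau}_1)$ and $\overline{a}:=\tfrac12(a(\boldsymbol{\tau}_1)+a(\boldsymbol{\tau}_2))$; here $a$ is one of $\varepsilon$, $\varepsilon_\rho$, $\rho\varepsilon_\rho$. *)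

(* Defs.v *)
From HB Require Import structures.
From mathcomp Require Import all_boot all_order all_algebra.
From mathcomp Require Import all_classical all_reals all_analysis.

Set Implicit Arguments.
Unset Strict Implicit.
Unset Printing Implicit Defensive.

Import Order.TTheory GRing.Theory Num.Theory.
Import numFieldNormedType.Exports.

Local Open Scope classical_set_scope.
Local Open Scope ring_scope.

Definition partial1 (R : realType) (f : R * R -> R) (x : R * R) : R :=
  'D_(1, 0) f x.

Definition partial2 (R : realType) (f : R * R -> R) (x : R * R) : R :=
  'D_(0, 1) f x.

(* [Ck_on k A f]: f is k times continuously differentiable on A.  For open A
   this is the usual notion; for A contained in the closure of its interior it
   means that the partial derivatives of order <= k, taken in the interior,
   extend continuously to A.  Only the values of f on A matter. *)
Fixpoint Ck_on (R : realType) (k : nat) (A : set (R * R)) (f : R * R -> R)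
    : Prop :=
  if k is k'.+1 then
    {within A, continuous f} /\
    exists g1 g2 : R * R -> R,
      [/\ forall x, (A°) x -> is_derive x (1, 0) f (g1 x),
          forall x, (A°) x -> is_derive x (0, 1) f (g2 x),
          Ck_on k' A g1 &
          Ck_on k' A g2]
  else {within A, continuous f}.

(* [T] is divided into a locally finite family of relatively closed pieces with
   pairwise disjoint interiors, each contained in the closure of its interior,
   and f is C^k on each piece up to its boundary. *)
Definition piecewise_Ck_on (R : realType) (k : nat) (T : set (R * R))
    (f : R * R -> R) : Prop :=
  exists D : nat -> set (R * R),
    [/\ \bigcup_i D i = T,
        forall x, T x -> exists2 U, nbhs x U &
          finite_set [set i | D i `&` U !=set0],
        forall i j, i != j -> (D i)° `&` (D j)° = set0,
        forall i, D i `<=` closure (D i)° /\ closure (D i) `&` T `<=` D i &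
        forall i, Ck_on k (D i) f].

(* Points of the (nu, sigma)-plane are pairs x, with x.1 = nu, x.2 = sigma. *)
Definition state_domain (R : realType) (smin : R) : set (R * R) :=
  [set x | 0 < x.1 /\ smin <= x.2].

(* A function on the state domain is represented by a total function whose
   values elsewhere are irrelevant. *)
Definition equation_of_state (R : realType) (smin : R) (e : R * R -> R)
    : Prop :=
  Ck_on 1 (state_domain smin) e /\ piecewise_Ck_on 2 (state_domain smin) e.

Definition hat_pressure (R : realType) (e : R * R -> R) (x : R * R) : R :=
  - partial1 e x.

Definition temperature (R : realType) (e : R * R -> R) (x : R * R) : R :=
  partial2 e x.

Record admissible_regime (R : realType) (smin : R) (e : R * R -> R)
    (S : set (R * R)) : Prop := AdmissibleRegime {
  regime_neq0 : S !=set0 ;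
  regime_open : open S ;
  regime_sub : S `<=` (state_domain smin)° ;
  regime_C2 : Ck_on 2 S e ;
  regime_pressure : forall x, S x -> 0 < hat_pressure e x ;
  regime_temperature : forall x, S x -> 0 < temperature e x ;
  regime_inj : forall nu s1 s2, S (nu, s1) -> S (nu, s2) ->
    e (nu, s1) = e (nu, s2) -> s1 = s2 ;
  regime_e11 : forall x, S x -> 0 < partial1 (partial1 e) x ;
  regime_e22 : forall x, S x -> 0 < partial2 (partial2 e) x ;
  regime_det : forall x, S x ->
    partial2 (partial1 e) x ^+ 2 <
    partial1 (partial1 e) x * partial2 (partial2 e) x }.

Definition density_energy (R : realType) (e : R * R -> R) (x : R * R)
    : R * R :=
  (x.1^-1, e x / x.1).

(* Points of the (rho, eps)-plane are pairs t, with t.1 = rho, t.2 = eps. *)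
Definition regime_image (R : realType) (e : R * R -> R) (S : set (R * R))
    : set (R * R) :=
  density_energy e @` S.

(* The inverse of [density_energy e] restricted to S; the default value [0] is
   only taken outside of [regime_image e S]. *)
Definition density_energy_inv (R : realType) (e : R * R -> R)
    (S : set (R * R)) : R * R -> R * R :=
  'pinv_(fun=> 0) S (density_energy e).

Definition pressure (R : realType) (e : R * R -> R) (S : set (R * R))
    (t : R * R) : R :=
  hat_pressure e (density_energy_inv e S t).

Definition isobar (R : realType) (e : R * R -> R) (S : set (R * R)) (P : R)
    : set (R * R) :=
  [set t | regime_image e S t /\ pressure e S t = P].

(* A regular C^1 parameterization, by an open interval I, of a relatively open
   part of G. *)
Record local_parameterization (R : realType) (G : set (R * R)) (I : set R)
    (phi : R -> R * R) : Prop := LocalParameterization {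
  param_open : open I ;
  param_interval : is_interval I ;
  param_derivable : forall t, I t -> derivable phi t 1 ;
  param_C1 : {within I, continuous (derive1 phi)} ;
  param_regular : forall t, I t -> derive1 phi t != 0 ;
  param_inj : forall t u, I t -> I u -> phi t = phi u -> t = u ;
  param_image : exists2 U, open U & phi @` I = G `&` U }.

Definition tangent_space (R : realType) (G : set (R * R)) (x : R * R)
    : set (R * R) :=
  [set v | exists (I : set R) (phi : R -> R * R) (t : R),
    [/\ local_parameterization G I phi, I t, phi t = x &
        exists s : R, v = s *: derive1 phi t]].

Definition tangent_line (R : realType) (G : set (R * R)) (x : R * R)
    : set (R * R) :=
  [set x + v | v in tangent_space G x].

Definition slope_defined (R : realType) (e : R * R -> R) (S : set (R * R))
    (t : R * R) : Prop :=
  partial2 (pressure e S) t != 0.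

Definition slope (R : realType) (e : R * R -> R) (S : set (R * R))
    (t : R * R) : R :=
  - (partial1 (pressure e S) t / partial2 (pressure e S) t).

Definition jump (R : realType) (t1 t2 : R * R) (a : R * R -> R) : R :=
  a t2 - a t1.

Definition mean (R : realType) (t1 t2 : R * R) (a : R * R -> R) : R :=
  (a t1 + a t2) / 2.

Definition compatible (R : realType) (e : R * R -> R) (S : set (R * R))
    (t1 t2 z : R * R) : Prop :=
  let eps (t : R * R) := t.2 in
  let eps_rho := slope e S in
  let rho_eps_rho (t : R * R) := t.1 * slope e S t in
  z.1 * jump t1 t2 eps_rho = jump t1 t2 rho_eps_rho - jump t1 t2 eps /\
  z.2 = mean t1 t2 eps + z.1 * mean t1 t2 eps_rho - mean t1 t2 rho_eps_rho.

(* Main.v *)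
Require Import Defs.
From HB Require Import structures.
From mathcomp Require Import all_boot all_order all_algebra.
From mathcomp Require Import all_classical all_reals all_analysis.
From mathcomp Require Import ring lra.
Import Order.TTheory GRing.Theory Num.Theory.
Import numFieldNormedType.Exports.
Local Open Scope classical_set_scope.
Local Open Scope ring_scope.

(** Where the slope m_i = eps_rho(tau_i) is defined, the tangent line to the
    isobar at tau_i is the graph eps - eps_i = m_i (rho - rho_i)
    ([tangent_line_isobar]).  The compatibility condition is an invertible
    linear recombination of these two line equations, namely their difference
    and their mean ([two_lines]), so its solutions are exactly the common points
    of the two tangent lines.  The statement about all pairs of points follows
    by quantifying over the pairs.

    All the analysis lies in the description of the tangent space, which is
    defined through local C^1 parameterizations.  For a level set of any C^1
    function f of two variables, the chain rule makes every tangent vector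
    orthogonal to the gradient ([level_set_tangent_orthogonal]), and where
    f_2 != 0 the implicit function theorem produces a local parameterization,
    so the orthogonality relation describes the whole tangent space
    ([level_set_parameterization], [level_set_tangent]).

    It remains to see that the pressure is C^1 on the open set S_tau, although
    it is defined through the inverse of Phi(nu, sigma) = (1/nu, e/nu)
    ([C1_on_pressure]).  The map Phi factors as the triangular map
    (nu, sigma) |-> (nu, e(nu, sigma)) followed by the involution
    (x, y) |-> (1/x, y/x).  The triangular map is open with C^1 inverse because
    e_sigma = T > 0.  The same result on triangular maps
    ([C1_graph_inverse]) is what serves as implicit function theorem for the
    level sets: to solve f(x, y) = c for y is to invert (x, y) |-> (x, f(x, y))
    along the line of second coordinate c.

    Differentiability is handled in the form of Hadamard and Caratheodory: f is
    differentiable at z when f w - f z = A w (w_1 - z_1) + B w (w_2 - z_2) near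
    z with A and B converging at z.  In this form the chain rule and the
    derivative of an inverse are algebraic identities. *)

(** * Differential calculus in the plane *)

Section PlaneCalculus.
Context {R : realType}.
Implicit Types (f g F A B : R * R -> R) (O : set (R * R)) (z w : R * R).

(** Differentiability of [f] at [z] with partial derivatives [a] and [b], in
    Caratheodory's form: the coefficients may depend on the increment, which
    replaces the remainder term. *)
Definition hadamard f z (a b : R) : Prop :=
  exists A B, [/\ A w @[w --> z] --> a, B w @[w --> z] --> b &
    \forall w \near z, f w - f z = A w * (w.1 - z.1) + B w * (w.2 - z.2)].

Lemma near_hadamard f g z a b :
  {near z, f =1 g} -> hadamard f z a b -> hadamard g z a b.
Proof.
move=> fg [A [B [Aa Bb H]]]; exists A, B; split=> //.
have fgz := nbhs_singleton fg.
by near=> w; rewrite -fgz -(near fg w)//; near: w.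
Unshelve. all: end_near. Qed.

Lemma cvg_fst_at z : w.1 @[w --> z] --> z.1.
Proof. exact: cvg_fst. Qed.

Lemma cvg_snd_at z : w.2 @[w --> z] --> z.2.
Proof. exact: cvg_snd. Qed.

Lemma hadamard_cvg f z a b : hadamard f z a b -> f w @[w --> z] --> f z.
Proof.
move=> [A [B [Aa Bb H]]].
have L : f z + (A w * (w.1 - z.1) + B w * (w.2 - z.2)) @[w --> z] -->
    f z + (a * (z.1 - z.1) + b * (z.2 - z.2)).
  apply: cvgD; first exact: cvg_cst.
  by apply: cvgD; apply: cvgM => //; apply: cvgB;
    [exact: cvg_fst_at|exact: cvg_cst|exact: cvg_snd_at|exact: cvg_cst].
rewrite !subrr !mulr0 !addr0 in L.
apply: cvg_trans L; apply: near_eq_cvg.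
by near=> w; rewrite -(near H w)// addrC subrK.
Unshelve. all: end_near. Qed.

Lemma hadamard_comp F (u v : R * R -> R) z (a b u1 u2 v1 v2 : R) :
  hadamard F (u z, v z) a b -> hadamard u z u1 u2 -> hadamard v z v1 v2 ->
  hadamard (fun w => F (u w, v w)) z (a * u1 + b * v1) (a * u2 + b * v2).
Proof.
move=> [A [B [Aa Bb HF]]] Hu Hv.
have cu := @hadamard_cvg _ _ _ _ Hu; have cv := @hadamard_cvg _ _ _ _ Hv.
have cuv : (u w, v w) @[w --> z] --> (u z, v z) by exact: (cvg_pair cu cv).
case: Hu => U1 [U2 [cU1 cU2 Hu]]; case: Hv => V1 [V2 [cV1 cV2 Hv]].
have cA : A (u w, v w) @[w --> z] --> a := cvg_comp _ _ cuv Aa.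
have cB : B (u w, v w) @[w --> z] --> b := cvg_comp _ _ cuv Bb.
exists (fun w => A (u w, v w) * U1 w + B (u w, v w) * V1 w).
exists (fun w => A (u w, v w) * U2 w + B (u w, v w) * V2 w).
split; [by apply: cvgD; exact: cvgM|by apply: cvgD; exact: cvgM|].
near=> w.
have -> : F (u w, v w) - F (u z, v z)
    = A (u w, v w) * (u w - u z) + B (u w, v w) * (v w - v z).
  by near: w; exact: (cuv _ HF).
rewrite (near Hu w)// (near Hv w)//; ring.
Unshelve. all: end_near. Qed.

(** The chain rule along a curve: after division by [h], the increment of
    [f \o c] is a combination of the difference quotients of the two components
    of [c], with coefficients that converge to [a] and [b]. *)
Lemma hadamard_along f z a b (c : R -> R * R) t dc :
  c t = z -> hadamard f z a b -> is_derive t 1 c dc ->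
  is_derive t 1 (f \o c) (a * dc.1 + b * dc.2).
Proof.
move=> cz [A [B [Aa Bb H]]] Dc.
have cc : c x @[x --> t] --> z.
  rewrite -cz; apply: differentiable_continuous.
  by apply/derivable1_diffP; case: Dc.
case: Dc => dcv dcE.
have {dcE dcv}Q : h^-1 *: (c (h + t) - c t) @[h --> 0^'] --> dc.
  rewrite -dcE; apply: cvg_trans dcv; apply: near_eq_cvg.
  by near=> h; rewrite /= [h *: 1]mulr1.
have c0 : (h + t) @[h --> (0:R)^'] --> t.
  rewrite -[X in _ --> X]add0r; apply: cvg_within_filter.
  by apply: cvgD; [exact: cvg_id|exact: cvg_cst].
have ch : c (h + t) @[h --> (0:R)^'] --> z := cvg_comp _ _ c0 cc.
have D : h^-1 *: ((f \o c) (h + t) - (f \o c) t) @[h --> 0^'] -->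
    a * dc.1 + b * dc.2.
  have L : A (c (h + t)) * (h^-1 *: (c (h + t) - c t)).1 +
           B (c (h + t)) * (h^-1 *: (c (h + t) - c t)).2 @[h --> (0:R)^'] -->
           a * dc.1 + b * dc.2.
    apply: cvgD; apply: cvgM.
    - exact: cvg_comp _ _ ch Aa.
    - exact: cvg_comp _ _ Q (cvg_fst_at _).
    - exact: cvg_comp _ _ ch Bb.
    - exact: cvg_comp _ _ Q (cvg_snd_at _).
  have Hh : \forall h \near (0:R)^', f (c (h + t)) - f z =
      A (c (h + t)) * ((c (h + t)).1 - z.1) +
      B (c (h + t)) * ((c (h + t)).2 - z.2) by exact: (ch _ H).
  apply: cvg_trans L; apply: near_eq_cvg; near=> h.
  rewrite /= cz (near Hh h)// /GRing.scale/=; ring.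
have E : (fun h : R => h^-1 *: (((f \o c) \o shift t) (h *: 1) - (f \o c) t)) =
         (fun h => h^-1 *: ((f \o c) (h + t) - (f \o c) t)).
  by apply/funext => h; rewrite /= [h *: 1]mulr1.
split.
  by rewrite /derivable E; apply/cvg_ex; exists (a * dc.1 + b * dc.2).
by rewrite /derive E; apply: cvg_lim.
Unshelve. all: end_near. Qed.


Lemma hadamard_derive f z v a b :
  hadamard f z a b -> is_derive z v f (a * v.1 + b * v.2).
Proof.
move=> H; pose c (h : R) := h *: v + z.
have c0 : c 0 = z by rewrite /c scale0r add0r.
have Dc : is_derive (0 : R) 1 c v.
  have L : h^-1 *: ((c \o shift 0) (h *: 1) - c 0) @[h --> (0 : R)^'] --> v.
    have L : cst v h @[h --> (0 : R)^'] --> v by exact: cvg_cst.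
    apply: cvg_trans L; apply: near_eq_cvg; near=> h.
    rewrite /c/= addr0 scale0r add0r addrK [h *: 1]mulr1.
    rewrite scalerA mulVf ?scale1r//.
    by near: h; exact: nbhs_dnbhs_neq.
  split; first by apply/cvg_ex; exists v.
  exact: cvg_lim L.
have := @hadamard_along _ _ _ _ _ _ _ c0 H Dc.
have E : (fun h : R => h^-1 *: (((f \o c) \o shift 0) (h *: 1) - (f \o c) 0)) =
         (fun h => h^-1 *: ((f \o shift z) (h *: v) - f z)).
  by apply/funext => h /=; rewrite addr0 [h *: 1]mulr1 c0.
by case; rewrite /derivable /derive E.
Unshelve. all: end_near. Qed.

Lemma hadamard_partial1 f z a b : hadamard f z a b -> partial1 f z = a.
Proof.
move=> H; rewrite /partial1.
by have [_ ->] := hadamard_derive _ _ (1, 0) _ _ H; rewrite mulr1 mulr0 addr0.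
Qed.

Lemma hadamard_partial2 f z a b : hadamard f z a b -> partial2 f z = b.
Proof.
move=> H; rewrite /partial2.
by have [_ ->] := hadamard_derive _ _ (0, 1) _ _ H; rewrite mulr1 mulr0 add0r.
Qed.

Lemma is_derive_section1 f z (a : R) :
  is_derive z (1, 0) f a -> is_derive z.1 1 (fun x => f (x, z.2)) a.
Proof.
have E : (fun h : R => h^-1 *: (((fun x => f (x, z.2)) \o shift z.1) (h *: 1)
            - f (z.1, z.2))) =
         (fun h => h^-1 *: ((f \o shift z) (h *: (1, 0)) - f z)).
  apply/funext => h /=; congr (_ *: (f _ - f _)); last by case: (z).
  by rewrite pair_equal_spec/= [h *: 0]mulr0 add0r.
by case; rewrite /derivable /derive -E => c <-.
Qed.

Lemma is_derive_section2 f z (b : R) :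
  is_derive z (0, 1) f b -> is_derive z.2 1 (fun y => f (z.1, y)) b.
Proof.
have E : (fun h : R => h^-1 *: (((fun y => f (z.1, y)) \o shift z.2) (h *: 1)
            - f (z.1, z.2))) =
         (fun h => h^-1 *: ((f \o shift z) (h *: (0, 1)) - f z)).
  apply/funext => h /=; congr (_ *: (f _ - f _)); last by case: (z).
  by rewrite pair_equal_spec/= [h *: 0]mulr0 add0r.
by case; rewrite /derivable /derive -E => c <-.
Qed.

(** The mean value theorem with the two points in either order, which is what
    expanding around an interior point requires. *)
Lemma MVT_ball (f df : R -> R) (c r x0 x : R) :
  (forall y, ball c r y -> is_derive y 1 f (df y)) ->
  ball c r x0 -> ball c r x ->
  exists2 y, ball c r y & f x - f x0 = df y * (x - x0).
Proof.
move=> D xr0 xr.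
have cf y : ball c r y -> {for y, continuous f}.
  move=> /D[d _].
  by apply: differentiable_continuous; apply/derivable1_diffP.
have sub (a b : R) : ball c r a -> ball c r b ->
    forall y, a <= y <= b -> ball c r y.
  rewrite /ball/= !ltr_distlC => /andP[a1 a2] /andP[b1 b2] y /andP[ay yb].
  by rewrite ltr_distlC (lt_le_trans a1)//= (le_lt_trans yb).
have seg (a b : R) : ball c r a -> ball c r b -> a <= b ->
    exists2 y, ball c r y & f b - f a = df y * (b - a).
  move=> ar br ab.
  have S := sub _ _ ar br.
  have [||y] := MVT_segment (f := f) (df := df) ab.
  - move=> y; rewrite in_itv/= => /andP[ay yb].
    by apply: D; apply: S; rewrite !ltW.
  - apply: continuous_in_subspaceT => y; rewrite inE/= in_itv/= => H.
    exact/cf/S.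
  - by rewrite in_itv/= => /S ? ?; exists y.
have [xx0|/ltW x0x] := leP x x0; last exact: seg.
have [y yr E] := seg _ _ xr xr0 xx0.
by exists y => //; rewrite -opprB E; ring.
Qed.

(** A function with continuous partial derivatives is differentiable: go from
    [z] to [w] first vertically and then horizontally, and apply the mean value
    theorem on each of the two segments. *)
Lemma hadamard_of_partials f f1 f2 z :
  (\forall w \near z, is_derive (w : R * R) (1, 0) f (f1 w)) ->
  (\forall w \near z, is_derive (w : R * R) (0, 1) f (f2 w)) ->
  f1 w @[w --> z] --> f1 z -> f2 w @[w --> z] --> f2 z ->
  hadamard f z (f1 z) (f2 z).
Proof.
move=> D1 D2 c1 c2.
pose A w := if w.1 == z.1 then f1 z else (f w - f (z.1, w.2)) / (w.1 - z.1).
pose B w := if w.2 == z.2 then f2 z else (f (z.1, w.2) - f z) / (w.2 - z.2).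
exists A, B; split.
- apply/cvgrPdist_lt => eps eps0.
  have N : \forall w \near z, is_derive (w : R * R) (1, 0) f (f1 w) /\
      `|f1 z - f1 w| < eps.
    by apply: filterI => //; move/cvgrPdist_lt : c1; apply.
  have [r /= r0 zr] := (iffLR (nbhs_ballP _ _) N).
  suff: \forall w \near z, `|f1 z - A w| < eps by [].
  apply/nbhs_ballP; exists r => //= w [w1 w2]; rewrite /A.
  case: eqVneq => [_|ne]; first by rewrite subrr normr0.
  have D y : ball z.1 r y -> is_derive y 1 (fun x => f (x, w.2)) (f1 (y, w.2)).
    move=> yr; have [D _] := zr (y, w.2) (conj yr w2).
    exact: (is_derive_section1 _ _ _ D).
  have [y yr] := MVT_ball _ _ _ _ _ _ D (ballxx _ r0) w1.
  rewrite -surjective_pairing => ->; rewrite mulfK ?subr_eq0//.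
  by have [] := zr (y, w.2) (conj yr w2).
- apply/cvgrPdist_lt => eps eps0.
  have N : \forall w \near z, is_derive (w : R * R) (0, 1) f (f2 w) /\
      `|f2 z - f2 w| < eps.
    by apply: filterI => //; move/cvgrPdist_lt : c2; apply.
  have [r /= r0 zr] := (iffLR (nbhs_ballP _ _) N).
  suff: \forall w \near z, `|f2 z - B w| < eps by [].
  apply/nbhs_ballP; exists r => //= w [w1 w2]; rewrite /B.
  case: eqVneq => [_|ne]; first by rewrite subrr normr0.
  have z1 : ball z.1 r z.1 by exact: ballxx.
  have D y : ball z.2 r y -> is_derive y 1 (fun x => f (z.1, x)) (f2 (z.1, y)).
    move=> yr; have [D _] := zr (z.1, y) (conj z1 yr).
    exact: (is_derive_section2 _ _ _ D).
  have [y yr] := MVT_ball _ _ _ _ _ _ D (ballxx _ r0) w2.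
  rewrite -surjective_pairing => ->; rewrite mulfK ?subr_eq0//.
  by have [] := zr (z.1, y) (conj z1 yr).
- near=> w; rewrite /A /B.
  have [e1|ne1] := eqVneq w.1 z.1; have [e2|ne2] := eqVneq w.2 z.2.
  + by rewrite (surjective_pairing w) (surjective_pairing z) e1 e2/=; ring.
  + rewrite divfK ?subr_eq0// -e1 -surjective_pairing; ring.
  + rewrite divfK ?subr_eq0// e2 -surjective_pairing; ring.
  + by rewrite !divfK ?subr_eq0//; ring.
Unshelve. all: end_near. Qed.

Definition C1_on O f : Prop := exists f1 f2, forall z, O z ->
  [/\ hadamard f z (f1 z) (f2 z), f1 w @[w --> z] --> f1 z &
      f2 w @[w --> z] --> f2 z].

Lemma C1_on_of_partials O f f1 f2 : open O ->
  (forall z, O z -> is_derive z (1, 0) f (f1 z)) ->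
  (forall z, O z -> is_derive z (0, 1) f (f2 z)) ->
  {within O, continuous f1} -> {within O, continuous f2} ->
  forall z, O z -> [/\ hadamard f z (f1 z) (f2 z), f1 w @[w --> z] --> f1 z &
      f2 w @[w --> z] --> f2 z].
Proof.
move=> Oo D1 D2; rewrite !continuous_open_subspace// => c1 c2 z Oz.
have z1 : f1 w @[w --> z] --> f1 z by apply: c1; rewrite inE.
have z2 : f2 w @[w --> z] --> f2 z by apply: c2; rewrite inE.
have Nz : nbhs z O by exact: open_nbhs_nbhs.
by split=> //; apply: hadamard_of_partials => //; near=> w;
  [apply: D1|apply: D2]; near: w.
Unshelve. all: end_near. Qed.

Lemma C1_on_comp O O' F (u v : R * R -> R) :
  C1_on O F -> C1_on O' u -> C1_on O' v -> (forall z, O' z -> O (u z, v z)) ->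
  C1_on O' (fun z => F (u z, v z)).
Proof.
move=> [F1 [F2 HF]] [u1 [u2 Hu]] [v1 [v2 Hv]] uvO.
exists (fun z => F1 (u z, v z) * u1 z + F2 (u z, v z) * v1 z).
exists (fun z => F1 (u z, v z) * u2 z + F2 (u z, v z) * v2 z).
move=> z O'z; have [hF cF1 cF2] := HF _ (uvO _ O'z).
have [hu cu1 cu2] := Hu _ O'z; have [hv cv1 cv2] := Hv _ O'z.
have cuv : (u w, v w) @[w --> z] --> (u z, v z).
  exact: (cvg_pair (hadamard_cvg _ _ _ _ hu) (hadamard_cvg _ _ _ _ hv)).
have cA : F1 (u w, v w) @[w --> z] --> F1 (u z, v z) := cvg_comp _ _ cuv cF1.
have cB : F2 (u w, v w) @[w --> z] --> F2 (u z, v z) := cvg_comp _ _ cuv cF2.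
split; first exact: hadamard_comp.
- by apply: cvgD; exact: cvgM.
- by apply: cvgD; exact: cvgM.
Qed.

Lemma eq_C1_on O f g : open O -> (forall z, O z -> f z = g z) ->
  C1_on O f -> C1_on O g.
Proof.
move=> Oo fg [f1 [f2 H]]; exists f1, f2 => z Oz; have [h c1 c2] := H _ Oz.
split=> //; apply: near_hadamard h; near=> w; apply: fg.
by near: w; exact: open_nbhs_nbhs.
Unshelve. all: end_near. Qed.

Lemma is_derive_pair (c1 c2 : R -> R) (t d1 d2 : R) :
  is_derive t 1 c1 d1 -> is_derive t 1 c2 d2 ->
  is_derive t 1 (fun x => (c1 x, c2 x)) (d1, d2).
Proof.
move=> [D1 E1] [D2 E2].
have L : h^-1 *: (((fun x => (c1 x, c2 x)) \o shift t) (h *: 1)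
                  - (c1 t, c2 t)) @[h --> (0 : R)^'] --> (d1, d2).
  by rewrite -E1 -E2; exact: (cvg_pair D1 D2).
split; first by apply/cvg_ex; exists (d1, d2).
exact: cvg_lim L.
Qed.

(** * Triangular maps *)

Definition graph_map F z : R * R := (z.1, F z).

Lemma nbhs_plane z (P : set (R * R)) :
  nbhs z P <-> exists2 r : R, 0 < r &
    forall x y, `|x - z.1| < r -> `|y - z.2| < r -> P (x, y).
Proof.
split=> [/nbhs_ballP[r /= r0 zP]|[r r0 zP]].
  by exists r => // x y xr yr; apply: zP; split; rewrite /ball/= distrC.
apply/nbhs_ballP; exists r => //= -[x y] [xr yr].
by apply: zP; rewrite distrC.
Qed.

(** Local surjectivity of a triangular map.  Since [b != 0], the function
    [F] takes values on both sides of [F z] at the two points [z.2 - d] and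
    [z.2 + d] of the vertical line through [z].  By continuity this persists on
    the nearby vertical lines for the nearby values, and the intermediate value
    theorem on these lines provides the preimages. *)
Lemma graph_map_open F O z (a b : R) (V : set (R * R)) :
  (\forall w \near z, F y @[y --> w] --> F w) ->
  hadamard F z a b -> b != 0 -> nbhs z V ->
  nbhs (graph_map F z) (graph_map F @` V).
Proof.
move=> Fc [A [B [_ Bb H]]] b0 Vz.
have Bb0 : \forall w \near z, 0 < B w * b.
  have L : B w * b @[w --> z] --> b * b by apply: cvgM => //; exact: cvg_cst.
  by move/cvgr_gt : L; apply; rewrite -expr2 exprn_even_gt0.
have N : nbhs z [set w | [/\ V w, F y @[y --> w] --> F w, 0 < B w * b &
    F w - F z = A w * (w.1 - z.1) + B w * (w.2 - z.2)]].
  by near=> w; split; near: w.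
have {H Fc Bb Bb0 Vz N}[r r0 N] := (iffLR (nbhs_plane _ _) N).
pose d := r / 2; have d0 : 0 < d by rewrite divr_gt0.
have dr : d < r by rewrite /d; lra.
have Nd y : `|y| <= d -> F w @[w --> (z.1, z.2 + y)] --> F (z.1, z.2 + y) /\
    exists2 k, 0 < k * b & F (z.1, z.2 + y) - F z = k * y.
  move=> yd; have [||_ c Bp E] := N z.1 (z.2 + y).
  - by rewrite subrr normr0.
  - by rewrite addrAC subrr add0r (le_lt_trans yd).
  split=> //; exists (B (z.1, z.2 + y)) => //.
  by rewrite E/=; ring.
have [|cp [kp kp0 Ep]] := Nd d; first by rewrite gtr0_norm.
have [|cm [km km0 Em]] := Nd (- d); first by rewrite normrN gtr0_norm.
(* [G w < 0] says that [w.2] lies strictly between the values of [F] at the two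
   ends of the vertical segment over [w.1]. *)
pose G w := (F (w.1, z.2 + d) - w.2) * (F (w.1, z.2 - d) - w.2).
have G0 : G (z.1, F z) < 0.
  rewrite /G/= Ep Em mulrACA mulrN -expr2 nmulr_llt0; last first.
    by rewrite oppr_lt0 exprn_gt0.
  have : 0 < (kp * b) * (km * b) by exact: mulr_gt0.
  by rewrite mulrACA -expr2 pmulr_lgt0// exprn_even_gt0.
have Gc : G w @[w --> (z.1, F z)] --> G (z.1, F z).
  have c1 (e : R) : (w.1, z.2 + e) @[w --> (z.1, F z)] --> (z.1, z.2 + e).
    exact: (cvg_pair (cvg_fst_at (z.1, F z)) (cvg_cst _)).
  have c2 := cvg_snd_at (z.1, F z).
  apply: cvgM; apply: cvgB => //.
  - exact: (cvg_comp _ _ (c1 d) cp).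
  - exact: (cvg_comp _ _ (c1 (- d)) cm).
have NG : nbhs (z.1, F z) [set w | G w < 0].
  by move/cvgr_lt : Gc; exact.
have Nr : nbhs (z.1, F z) [set w | `|w.1 - z.1| < r].
  apply/nbhs_plane; exists r => //.
suff : \forall w \near (z.1, F z), (graph_map F @` V) w by [].
near=> w.
have Gw : G w < 0 by near: w.
have w1r : `|w.1 - z.1| < r by near: w.
have yr y : z.2 - d <= y <= z.2 + d -> `|y - z.2| < r.
  by move=> /andP[y1 y2]; rewrite ltr_distlC; apply/andP; split; lra.
have [|||y yI yE] := @IVT R (fun y => F (w.1, y)) (z.2 - d) (z.2 + d) w.2.
- by lra.
- apply: continuous_in_subspaceT => y; rewrite inE/= in_itv/= => /yr yr'.
  have [_ c _ _] := N _ _ w1r yr'.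
  have cy : (w.1, t) @[t --> y] --> (w.1, y).
    exact: (cvg_pair (cvg_cst _) cvg_id).
  exact: (cvg_comp _ _ cy c).
- rewrite ge_min le_max; move: Gw; rewrite /G.
  case: (leP (F (w.1, z.2 - d)) w.2) => m1;
  case: (leP (F (w.1, z.2 + d)) w.2) => m2 //= Gw.
  + by exfalso; nra.
  + by rewrite (ltW m2) orbT.
  + by rewrite (ltW m1).
  + by exfalso; nra.
move: yI; rewrite in_itv/= => /yr yr'.
have [Vw _ _ _] := N _ _ w1r yr'.
by exists (w.1, y) => //; rewrite /graph_map/= yE -surjective_pairing.
Unshelve. all: end_near. Qed.

Lemma C1_on_cvg O F z : C1_on O F -> O z -> F w @[w --> z] --> F z.
Proof. by move=> [F1 [F2 H]] /H[hF _ _]; exact: hadamard_cvg hF. Qed.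

(** The inverse function theorem for the triangular map
    [(x, y) |-> (x, F (x, y))], with [s] the second component of a global left
    inverse.  Openness makes this inverse continuous; solving
    [dF = A dx + B dy] for [dy] then gives
    [ds = (dF - A dx) / B], with [A] and [B] taken at the inverse image. *)
Lemma C1_graph_inverse O F s : open O -> C1_on O F ->
  (forall z, O z -> partial2 F z != 0) ->
  (forall z, O z -> s (graph_map F z) = z.2) ->
  open (graph_map F @` O) /\ C1_on (graph_map F @` O) s.
Proof.
move=> Oo FC1 F20 sK.
have Fc z : O z -> F w @[w --> z] --> F z by exact: C1_on_cvg.
have [F1 [F2 HF]] := FC1.
have {}F20 z : O z -> F2 z != 0.
  by move=> Oz; have [/hadamard_partial2 <- _ _] := HF _ Oz; exact: F20.
have NO z : O z -> nbhs z O by move=> Oz; exact: open_nbhs_nbhs.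
have img z V : O z -> nbhs z V ->
    nbhs (graph_map F z) (graph_map F @` (V `&` O)).
  move=> Oz Vz; have [h _ _] := HF _ Oz.
  apply: (graph_map_open _ O _ _ _ _ _ h (F20 _ Oz)).
    by near=> w; apply: Fc; near: w; exact: NO.
  by apply: filterI => //; exact: NO.
have Wo : open (graph_map F @` O).
  rewrite openE => _ [z Oz <-]; rewrite /interior.
  by have := img z O Oz (NO _ Oz); rewrite setIid.
split=> //.
pose theta w : R * R := (w.1, s w).
have thetaK z : O z -> theta (graph_map F z) = z.
  by move=> Oz; rewrite /theta sK//=; case: (z).
exists (fun w => - F1 (theta w) / F2 (theta w)), (fun w => (F2 (theta w))^-1).
move=> _ [z Oz <-]; rewrite thetaK//.
set w0 := graph_map F z.
have ct : theta w @[w --> w0] --> z.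
  move=> V Vz.
  apply: filterS (img z V Oz Vz) => _ [y [Vy Oy] <-].
  by rewrite /preimage/= thetaK.
have [hF c1 c2] := HF _ Oz; have F2z := F20 _ Oz.
have ct1 : F1 (theta w) @[w --> w0] --> F1 z := cvg_comp _ _ ct c1.
have ct2 : F2 (theta w) @[w --> w0] --> F2 z := cvg_comp _ _ ct c2.
split; last 2 first.
- by apply: cvgM; [exact: cvgN|exact: cvgV].
- exact: cvgV.
have [A [B [Aa Bb H]]] := hF.
have cA : A (theta w) @[w --> w0] --> F1 z := cvg_comp _ _ ct Aa.
have cB : B (theta w) @[w --> w0] --> F2 z := cvg_comp _ _ ct Bb.
exists (fun w => - A (theta w) / B (theta w)), (fun w => (B (theta w))^-1).
split; [by apply: cvgM; [exact: cvgN|exact: cvgV]|exact: cvgV|].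
have Hth : \forall w \near w0, F (theta w) - F z =
  A (theta w) * ((theta w).1 - z.1) + B (theta w) * ((theta w).2 - z.2).
  exact: (ct _ H).
have B0 : \forall w \near w0, B (theta w) != 0 by move/cvgr_neq0 : cB; exact.
near=> w.
have [y Oy yw] : (graph_map F @` O) w.
  by near: w; apply: open_nbhs_nbhs; split=> //; exists z.
have Bw : B (theta w) != 0 by near: w.
have : F (theta w) - F z =
    A (theta w) * ((theta w).1 - z.1) + B (theta w) * ((theta w).2 - z.2).
  by near: w; exact: Hth.
move: Bw; rewrite -yw thetaK// /w0 !sK//= => By ->.
by field.
Unshelve. all: end_near. Qed.

(** * Tangent spaces of level sets *)

Definition level_set O f (c : R) : set (R * R) := [set z | O z /\ f z = c].

(** Differentiate the constant [f \o phi] for any parameterization [phi]. *)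
Lemma level_set_tangent_orthogonal O f (c : R) z v : C1_on O f ->
  tangent_space (level_set O f c) z v ->
  partial1 f z * v.1 + partial2 f z * v.2 = 0.
Proof.
move=> [f1 [f2 H]] [I [phi [t [phiP It <- [k ->]]]]].
have onG x : I x -> level_set O f c (phi x).
  move=> Ix; have [U _ E] := param_image phiP.
  by have [] : (level_set O f c `&` U) (phi x) by rewrite -E; exists x.
have [h _ _] := H _ (onG _ It).1.
rewrite (hadamard_partial1 _ _ _ _ h) (hadamard_partial2 _ _ _ _ h).
have D : is_derive t 1 phi (derive1 phi t).
  by rewrite derive1E; apply: DeriveDef => //; exact: param_derivable phiP _ It.
have [_ <-] := is_derive_cst c t (1 : R).
have [_] := hadamard_along _ _ _ _ _ _ _ erefl h D.
have -> : 'D_1 (f \o phi) t = 'D_1 (cst c) t.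
  apply: near_eq_derive; near=> x; apply: (onG x _).2.
  by near: x; apply: open_nbhs_nbhs; split=> //; exact: param_open phiP.
rewrite derive_cst => /= E.
by rewrite !mulrA ![_ * k]mulrC -!mulrA -mulrDr -E mulr0.
Unshelve. all: end_near. Qed.

(** The implicit function theorem, as a graph over the first coordinate.  On a
    ball where the second partial derivative does not vanish, the triangular map of
    [f] is injective by the mean value theorem, and its inverse restricted to
    the horizontal line of height [c] is the graph. *)
Lemma level_set_parameterization O f (c : R) z : open O -> C1_on O f ->
  level_set O f c z -> partial2 f z != 0 ->
  exists (I : set R) (phi : R -> R * R) (t : R),
    [/\ local_parameterization (level_set O f c) I phi, I t & phi t = z].
Proof.
move=> Oo fC1 [Oz fz] f2z; have [f1 [f2 H]] := fC1.
have [r r0 zr] : exists2 r : R, 0 < r &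
    forall w, ball z r w -> O w /\ f2 w != 0.
  suff /nbhs_ballP[r r0 zr] : nbhs z [set w | O w /\ f2 w != 0] by exists r.
  apply: filterI; first exact: open_nbhs_nbhs.
  have [h _ c2] := H _ Oz.
  rewrite (hadamard_partial2 _ _ _ _ h) in f2z.
  by move/cvgr_neq0 : c2; exact.
pose V : set (R * R) := ball z r.
have Vo : open V by exact: ball_open.
have VO w : V w -> O w by move=> /zr[].
have fC1V : C1_on V f by exists f1, f2 => w /VO; exact: H.
have f2V w : V w -> partial2 f w != 0.
  by move=> /zr[/H[/hadamard_partial2 -> _ _]].
have inj : {in V &, injective (graph_map f)}.
  move=> [x1 y1] [x2 y2]; rewrite !inE => V1 V2 [/= x12 f12].
  rewrite -x12 in V2 f12 *; congr pair.
  have D y : ball z.2 r y -> is_derive y 1 (fun y => f (x1, y)) (f2 (x1, y)).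
    move=> yr; have [h _ _] : [/\ hadamard f (x1, y) (f1 (x1, y)) (f2 (x1, y)),
        f1 w @[w --> (x1, y)] --> f1 (x1, y) &
        f2 w @[w --> (x1, y)] --> f2 (x1, y)].
      by apply/H/VO; split=> //; exact: V1.1.
    have h1 := hadamard_derive _ _ (0, 1) _ _ h.
    have := is_derive_section2 _ _ _ h1.
    by rewrite /= mulr0 add0r mulr1.
  have [y yr] := MVT_ball _ _ _ _ _ _ D V1.2 V2.2.
  rewrite /= f12 subrr => /esym/eqP; rewrite mulf_eq0 subr_eq0.
  have [_ /negPf-> /=] := zr (x1, y) (conj V1.1 yr).
  by move=> /eqP.
pose s w := ('pinv_(fun=> 0) V (graph_map f) w).2.
have sK w : V w -> s (graph_map f w) = w.2.
  by move=> Vw; rewrite /s pinvKV ?inE.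
have [Wo [s1 [s2 Hs]]] := C1_graph_inverse _ _ _ Vo fC1V f2V sK.
set W := graph_map f @` V in Wo Hs.
have Vz : V z by exact: ballxx.
have [d d0 zd] : exists2 d : R, 0 < d & forall x, ball z.1 d x -> W (x, c).
  have : nbhs (z.1, c) W.
    by apply: open_nbhs_nbhs; split=> //; exists z => //; rewrite /graph_map fz.
  move=> /nbhs_ballP[d d0 zd]; exists d => // x xd.
  by apply: zd; split=> //; exact: ballxx.
pose I : set R := ball z.1 d.
pose phi x := (x, s (x, c)).
have VI x : I x -> V (phi x) /\ f (phi x) = c.
  move=> /zd[[x' y] Vy [/= xx' fc]].
  by rewrite xx' in Vy fc *; rewrite /phi -fc (sK (x, y)).
have Io : open I by exact: ball_open.
have D x : I x -> is_derive x 1 phi (1, s1 (x, c)).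
  move=> Ix; apply: is_derive_pair => //.
  have [h _ _] := Hs _ (zd _ Ix).
  have Dc : is_derive x 1 (fun y : R => (y, c)) (1, 0).
    exact: is_derive_pair.
  have := hadamard_along _ _ _ _ _ _ _ erefl h Dc.
  by rewrite /= mulr1 mulr0 addr0.
have D1 x : I x -> derive1 phi x = (1, s1 (x, c)).
  by move=> /D[_ <-]; rewrite derive1E.
exists I, phi, z.1; split.
- split=> //.
  + move=> x y; rewrite /I/= /ball/= => xI yI t.
    rewrite !ltr_distlC in xI yI * => /andP[xt ty].
    case/andP: xI => xI _; case/andP: yI => _ yI.
    by rewrite (lt_le_trans xI)//= (le_lt_trans ty).
  + by move=> x /D[].
  + rewrite continuous_open_subspace// => x; rewrite inE => Ix.
    have [_ cs1 _] := Hs _ (zd _ Ix).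
    have cx : (y, c) @[y --> x] --> (x, c).
      exact: (cvg_pair cvg_id (cvg_cst _)).
    have L : (1 : R, s1 (y, c)) @[y --> x] --> (1 : R, s1 (x, c)).
      exact: (cvg_pair (cvg_cst _) (cvg_comp _ _ cx cs1)).
    rewrite /continuous_at D1//; apply: cvg_trans L; apply: near_eq_cvg.
    have Nx : nbhs x I by apply: open_nbhs_nbhs.
    near=> y; have Iy : I y by near: y.
    by rewrite D1.
  + move=> x Ix; rewrite D1//; apply/eqP => -[/eqP].
    by rewrite oner_eq0.
  + by move=> x y _ _ [].
  + exists (V `&` fst @^-1` I).
      apply: openI => //; apply: open_comp => // w _; exact: cvg_fst_at.
    rewrite eqEsubset; split=> [_ [x Ix <-]|w [[Ow fw] [Vw Iw]]].
      have [Vx fx] := VI _ Ix; split; split=> //; exact: VO.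
    exists w.1 => //; rewrite /phi -fw (sK w)//; by case: (w).
- exact: ballxx.
- by rewrite /phi -fz (sK z)//; case: (z).
Unshelve. all: end_near. Qed.

(** The orthogonality relation cuts out a line, because [f_2 != 0], and one
    regular parameterization has a nonzero velocity on this line, hence spans it. *)
Lemma level_set_tangent O f (c : R) z v : open O -> C1_on O f ->
  level_set O f c z -> partial2 f z != 0 ->
  tangent_space (level_set O f c) z v <->
  v.2 = - (partial1 f z / partial2 f z) * v.1.
Proof.
move=> Oo fC1 Gz f2z.
have sol (w : R * R) : partial1 f z * w.1 + partial2 f z * w.2 = 0 ->
    w.2 = - (partial1 f z / partial2 f z) * w.1.
  move=> /eqP; rewrite addrC addr_eq0 => /eqP E.
  by apply: (mulfI f2z); rewrite E; field.
split=> [/(level_set_tangent_orthogonal _ _ _ _ _ fC1)|vE]; first exact: sol.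
have [I [phi [t [phiP It phit]]]] :=
  level_set_parameterization _ _ _ _ Oo fC1 Gz f2z.
have /(level_set_tangent_orthogonal _ _ _ _ _ fC1)/sol dE :
    tangent_space (level_set O f c) z (derive1 phi t).
  by exists I, phi, t; split=> //; exists 1; rewrite scale1r.
have d0 : (derive1 phi t).1 != 0.
  apply: contra (param_regular phiP It) => /eqP d1.
  by rewrite (surjective_pairing (derive1 phi t)) dE d1 mulr0.
exists I, phi, t; split=> //; exists (v.1 / (derive1 phi t).1).
have scE (k : R) (w : R * R) : k *: w = (k * w.1, k * w.2) by [].
rewrite scE [LHS]surjective_pairing vE dE; congr pair; first by rewrite divfK.
by rewrite mulrCA divfK.
Qed.

End PlaneCalculus.

(** * The pressure in density-energy coordinates *)

Lemma Ck_on_C1 (R : realType) (k : nat) (O : set (R * R)) (f : R * R -> R) :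
  open O -> Ck_on k.+1 O f -> C1_on O f.
Proof.
move=> Oo [_ [f1 [f2 [D1 D2 c1 c2]]]].
rewrite (interior_id O).1// in D1 D2.
exists f1, f2; apply: C1_on_of_partials => //.
- by case: (k) c1 => // k' [].
- by case: (k) c2 => // k' [].
Qed.

Lemma C1_on_opp (R : realType) (O : set (R * R)) (f : R * R -> R) :
  C1_on O f -> C1_on O (fun z => - f z).
Proof.
move=> [f1 [f2 H]]; exists (fun z => - f1 z), (fun z => - f2 z) => z Oz.
have [[A [B [Aa Bb E]]] c1 c2] := H _ Oz.
split; [|exact: cvgN|exact: cvgN].
exists (fun w => - A w), (fun w => - B w); split; [exact: cvgN|exact: cvgN|].
near=> w; transitivity (- (f w - f z)); first by ring.
by rewrite (near E w)//; ring.
Unshelve. all: end_near. Qed.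

(** This involution exchanges the pairs (volume, energy per mass) and
    (density, energy per volume). *)
Definition density_swap (R : realType) (w : R * R) : R * R :=
  (w.1^-1, w.2 / w.1).

Lemma density_swapK (R : realType) (w : R * R) :
  w.1 != 0 -> density_swap R (density_swap R w) = w.
Proof.
by case: w => x y /= x0; rewrite /density_swap/= invrK divfK.
Qed.

Lemma C1_on_density_swap (R : realType) :
  let O := [set w : R * R | w.1 != 0] in
  C1_on O (fun w => (density_swap R w).1) /\
  C1_on O (fun w => (density_swap R w).2).
Proof.
move=> O.
have cinv (z : R * R) : O z -> w.1^-1 @[w --> z] --> z.1^-1.
  by move=> z0; apply: cvgV => //; exact: cvg_fst_at.
have c2 (z : R * R) : w.2 @[w --> z] --> z.2 := cvg_snd_at z.
have N0 (z : R * R) : O z -> \forall w \near z, w.1 != 0.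
  by move=> z0; move/cvgr_neq0 : (cvg_fst_at z); exact.
split.
- exists (fun z => - (z.1^-1 * z.1^-1)), (fun=> 0) => z z0.
  have ci := cinv _ z0.
  split; [|by apply: cvgN; exact: cvgM|exact: cvg_cst].
  exists (fun w => - (w.1^-1 * z.1^-1)), (fun=> 0); split.
  + by apply: cvgN; apply: cvgM => //; exact: cvg_cst.
  + exact: cvg_cst.
  + near=> w; have w0 : w.1 != 0 by near: w; exact: N0.
    by rewrite /density_swap/=; field; rewrite w0 z0.
- exists (fun z => - (z.2 * (z.1^-1 * z.1^-1))), (fun z => z.1^-1) => z z0.
  have ci := cinv _ z0.
  split; [|exact: (cvgN (cvgM (c2 z) (cvgM ci ci)))|by []].
  exists (fun w => - (z.2 * (w.1^-1 * z.1^-1))), (fun w => w.1^-1); split=> //.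
  + exact: (cvgN (cvgM (cvg_cst _) (cvgM ci (cvg_cst _)))).
  + near=> w; have w0 : w.1 != 0 by near: w; exact: N0.
    by rewrite /density_swap/=; field; rewrite w0 z0.
Unshelve. all: end_near. Qed.

Lemma sub_C1_on (R : realType) (O O' : set (R * R)) (f : R * R -> R) :
  O' `<=` O -> C1_on O f -> C1_on O' f.
Proof. by move=> sO [f1 [f2 H]]; exists f1, f2 => z /sO; exact: H. Qed.

(** The left-hand conditions are the difference and the mean of the equations of
    the two lines. *)
Lemma two_lines (K : realFieldType) (x1 y1 m1 x2 y2 m2 x y : K) :
  (x * (m2 - m1) = x2 * m2 - x1 * m1 - (y2 - y1) /\
   y = (y1 + y2) / 2 + x * ((m1 + m2) / 2) - (x1 * m1 + x2 * m2) / 2) <->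
  (y - y1 = m1 * (x - x1) /\ y - y2 = m2 * (x - x2)).
Proof. by split=> -[E1 E2]; split; lra. Qed.

Section Regime.
Context {R : realType} (smin : R) (e : R * R -> R) (S : set (R * R))
  (adm : admissible_regime smin e S).

Let S_tau := regime_image e S.
Let p := pressure e S.

Lemma regime_volume_neq0 x : S x -> x.1 != 0.
Proof.
move=> /(regime_sub adm)/interior_subset[x0 _].
by rewrite gt_eqF.
Qed.

Lemma density_energyE x : density_energy e x = density_swap R (graph_map e x).
Proof. by []. Qed.

Lemma density_energyK x : S x ->
  density_energy_inv e S (density_energy e x) = x.
Proof.
move=> Sx; apply: pinvKV; last by rewrite inE.
move=> {Sx}[n s] [n' s']; rewrite !inE => Sx Sy [/invr_inj/= nn' E].
rewrite -nn' in Sy E *; congr pair.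
apply: (regime_inj adm Sx Sy).
by apply: (mulIf (invr_neq0 (regime_volume_neq0 _ Sx))).
Qed.

(** The entropy as a function of volume and energy per mass; it inverts the
    triangular map of [e]. *)
Let entropy w := (density_energy_inv e S (density_swap R w)).2.

Lemma entropyK x : S x -> entropy (graph_map e x) = x.2.
Proof. by move=> Sx; rewrite /entropy -density_energyE density_energyK. Qed.

Lemma C1_on_entropy :
  open (graph_map e @` S) /\ C1_on (graph_map e @` S) entropy.
Proof.
have So := regime_open adm.
apply: C1_graph_inverse => //.
- exact: (Ck_on_C1 _ _ _ _ So (regime_C2 adm)).
- by move=> x /(regime_temperature adm) /lt0r_neq0.
- exact: entropyK.
Qed.

Lemma regime_image_neq0 t : S_tau t -> t.1 != 0.
Proof. by move=> [x /regime_volume_neq0 x0 <-]; exact: invr_neq0. Qed.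

Lemma density_swap_regime t : S_tau t -> (graph_map e @` S) (density_swap R t).
Proof.
move=> [x Sx <-]; rewrite density_energyE density_swapK.
  by exists x.
exact: (regime_volume_neq0 _ Sx).
Qed.

(** S_tau is the preimage under [density_swap] of the open image of the
    triangular map of [e]. *)
Lemma open_regime_image : open S_tau.
Proof.
have [Wo _] := C1_on_entropy; have [s1 s2] := C1_on_density_swap R.
rewrite openE => t Tt; have t0 := regime_image_neq0 _ Tt.
have ct : density_swap R w @[w --> t] --> density_swap R t.
  exact: (cvg_pair (C1_on_cvg _ _ _ s1 t0) (C1_on_cvg _ _ _ s2 t0)).
have N1 : \forall w \near t, (graph_map e @` S) (density_swap R w).
  by apply: ct; apply: open_nbhs_nbhs; split=> //; exact: density_swap_regime.
have N2 : \forall w \near t, w.1 != 0.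
  by move/cvgr_neq0 : (cvg_fst_at t); exact.
rewrite /interior; near=> w.
have w0 : w.1 != 0 by near: w.
have [x Sx E] : (graph_map e @` S) (density_swap R w) by near: w.
by exists x => //; rewrite density_energyE E density_swapK.
Unshelve. all: end_near. Qed.

(** On S_tau the pressure is [- e_nu] composed with the C^1 map that recovers
    the volume and the entropy from the density and the energy per volume. *)
Lemma C1_on_pressure : C1_on S_tau p.
Proof.
have So := regime_open adm.
have [_ [g1 [g2 [D1 _ g1C1 _]]]] := regime_C2 adm.
rewrite (interior_id S).1// in D1.
have FC1 := C1_on_opp _ _ _ (Ck_on_C1 _ 0%N _ _ So g1C1).
have [s1 s2] := C1_on_density_swap R.
have Ts : S_tau `<=` [set w | w.1 != 0] by exact: regime_image_neq0.
have {}s1 := sub_C1_on _ _ _ _ Ts s1; have {}s2 := sub_C1_on _ _ _ _ Ts s2.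
have [_ entC1] := C1_on_entropy.
have vC1 := C1_on_comp _ _ _ _ _ entC1 s1 s2 density_swap_regime.
have invE t : S_tau t -> density_energy_inv e S t =
    ((density_swap R t).1, entropy (density_swap R t)).
  move=> Tt; rewrite /entropy density_swapK; last exact: regime_image_neq0.
  case: Tt => x Sx <-; rewrite density_energyK//= invrK.
  by case: (x).
have invS t : S_tau t -> S ((density_swap R t).1, entropy (density_swap R t)).
  by move=> Tt; rewrite -invE//; case: Tt => x Sx <-; rewrite density_energyK.
have pC1 := C1_on_comp _ _ _ _ _ FC1 s1 vC1 invS.
apply: (eq_C1_on _ _ _ open_regime_image _ pC1).
move=> t Tt; rewrite /p /pressure invE//.
by rewrite /hat_pressure /partial1; have [_ ->] := D1 _ (invS _ Tt).
Qed.

(** * Tangent lines of isobars and compatibility *)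

Lemma tangent_line_isobar (P : R) (t z : R * R) :
  isobar e S P t -> slope_defined e S t ->
  tangent_line (isobar e S P) t z <-> z.2 - t.2 = slope e S t * (z.1 - t.1).
Proof.
move=> Gt st.
have H v :=
  level_set_tangent S_tau p P t v open_regime_image C1_on_pressure Gt st.
split=> [[v /H vE <-]|zE].
  by rewrite /slope/= addrAC subrr add0r addrAC subrr add0r vE.
exists (z - t); last by rewrite addrC subrK.
exact/H.
Qed.

Lemma compatible_isobar (P : R) (t1 t2 z : R * R) :
  isobar e S P t1 -> isobar e S P t2 ->
  slope_defined e S t1 -> slope_defined e S t2 ->
  compatible e S t1 t2 z <->
  (tangent_line (isobar e S P) t1 `&` tangent_line (isobar e S P) t2) z.
Proof.
move=> G1 G2 st1 st2.
have L1 := tangent_line_isobar P t1 z G1 st1.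
have L2 := tangent_line_isobar P t2 z G2 st2.
split=> [/two_lines[/L1 ? /L2 ?]//|[/L1 E1 /L2 E2]].
exact/two_lines.
Qed.

End Regime.

Theorem mainTheorem3 (R : realType) (smin : R) (e : R * R -> R)
    (S : set (R * R)) (P : R) :
  equation_of_state smin e ->
  admissible_regime smin e S ->
  0 < P ->
  let G := isobar e S P in
  (forall t1 t2 : R * R,
     G t1 -> G t2 -> slope_defined e S t1 -> slope_defined e S t2 ->
     forall z : R * R,
       compatible e S t1 t2 z <->
       (tangent_line G t1 `&` tangent_line G t2) z) /\
  ((forall t : R * R, G t -> slope_defined e S t) ->
   ((forall t1 t2 : R * R, G t1 -> G t2 ->
       exists z : R * R, compatible e S t1 t2 z) <->
    (forall t1 t2 : R * R, G t1 -> G t2 ->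
       tangent_line G t1 `&` tangent_line G t2 !=set0))).
Proof.
move=> _ adm _ G.
have H t1 t2 : G t1 -> G t2 -> slope_defined e S t1 -> slope_defined e S t2 ->
    forall z, compatible e S t1 t2 z <->
              (tangent_line G t1 `&` tangent_line G t2) z.
  by move=> G1 G2 s1 s2 z; exact: (compatible_isobar _ _ _ adm).
split=> // sG; split=> K t1 t2 G1 G2; have [z zK] := K _ _ G1 G2; exists z;
  by apply/H => //; exact: sG.
Qed.
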